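(* Let $h \ge 1$ and $m, k \ge 2$ be integers. Then, for $T = T_{m,k}$ (with $k \ge 4$), $T = T_{m,\infty}$, $T=\hat{T}_{m,k}$ or $T=\hat{T}_{m,\infty}$, $$\sigma_{h,1,1}(T) = \sigma^*_{h,1,1}(T) = \max\{h+2m+1,\ 2h+m\}.$$
   Context: $N(u)$ is the neighbourhood of $u$ and $d(u,v)$ the distance between $u$ and $v$. For a positive integer $\ell$, $|x|_\ell=\min\{|x|,\ell-|x|\}$. A $C(h_1,h_2,h_3)$-labelling of a (finite or countably infinite) graph $G$ with span $\ell$ is a mapping $f: V(G)\to\{0,1,\ldots,\ell-1\}$ such that for $i=1,2,3$ and any $u,v\in V(G)$ with $d(u,v)=i$ we have $|f(u)-f(v)|_\ell\ge h_i$. $\sigma_{h_1,h_2,h_3}(G)$ is the minimum integer $\ell$ such that $G$ admits a $C(h_1,h_2,h_3)$-labelling with span $\ell$. An interval modulo $\ell$ is a set of the form $\{a \bmod \ell, (a+1) \bmod \ell, \ldots, b \bmod \ell\}$ (going cyclically from $a$ to $b$). A $C(h_1,h_2,h_3)$-labelling $f$ with span $\ell$ is elegant if for every vertex $u$ there is an interval $I_u$ modulo $\ell$ such that $f(N(u))\subseteq I_u$, and for every edge $uv$, $I_u\cap I_v=\emptyset$. $\sigma^*_{h_1,h_2,h_3}(G)$ is the minimum $\ell$ such that $G$ admits an elegant $C(h_1,h_2,h_3)$-labelling with span $\ell$ ($\infty$ if none exists). $T_{m,k}$ is the complete $m$-ary tree of height $k$: the rooted tree in which every non-leaf vertex has exactly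 $m$ children and all leaves are at level (distance from the root) $k$. $T_{m,\infty}$ is the infinite complete $m$-ary tree: the rooted tree with countably infinitely many vertices in which every vertex (including the root) has exactly $m$ children. $\hat{T}_{m,\infty}$ is the infinite $(m+1)$-regular tree, and $\hat{T}_{m,k}$ is its finite subtree induced by all vertices at distance at most $k$ from a fixed vertex. *)

(* Defs.v *)
From HB Require Import structures.
From mathcomp Require Import all_boot all_order all_algebra.
From mathcomp Require Import boolp.

Set Implicit Arguments.
Unset Strict Implicit.
Unset Printing Implicit Defensive.

(* Minimum of a set of natural numbers; [None] stands for infinity. *)
Definition min_nat (P : nat -> Prop) : option nat :=
  if pselect (exists n, `[< P n >]) is left exP then Some (ex_minn exP)
  else None.

(* Simple graphs, finite or countably infinite. *)
Record graph := Graph {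
  vertex :> countType;
  adj : rel vertex;
  adj_sym : symmetric adj;
  adj_irr : irreflexive adj
}.

Definition walk (G : graph) (n : nat) (u v : G) : Prop :=
  exists p : seq G, [/\ path (@adj G) u p, last u p = v & size p = n].

Definition dist (G : graph) (u v : G) : option nat :=
  min_nat (fun n => walk n u v).

Section Induced.
Variables (G : graph) (P : pred G).

Definition induced_adj : rel {v : G | P v} := fun u v => adj (val u) (val v).

Fact induced_adj_sym : symmetric induced_adj.
Proof. by move=> u v; apply: adj_sym. Qed.

Fact induced_adj_irr : irreflexive induced_adj.
Proof. by move=> u; apply: adj_irr. Qed.

Definition induced : graph := Graph induced_adj_sym induced_adj_irr.
End Induced.

Definition ball (G : graph) (c : G) (k : nat) : graph :=
  induced (fun v : G => `[< exists2 i, dist c v = Some i & i <= k >]).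

(* |x|_l ; only used for |x| < l, where the subtraction is not truncated. *)
Definition cyc_abs (l : nat) (x : int) : nat := minn (absz x) (l - absz x).

Definition is_labelling (h1 h2 h3 : nat) (G : graph) (l : nat)
    (f : G -> 'I_l) : Prop :=
  forall u v : G,
    let gap := cyc_abs l ((f u)%:Z - (f v)%:Z)%R in
    [/\ dist u v = Some 1 -> h1 <= gap,
        dist u v = Some 2 -> h2 <= gap &
        dist u v = Some 3 -> h3 <= gap].

(* The set {a mod l, (a+1) mod l, ..., b mod l}; an interval wrapping around 0
   is obtained by taking l <= b. *)
Definition is_interval_mod (l : nat) (I : {set 'I_l}) : Prop :=
  exists a b : nat, a <= b /\
    forall x : 'I_l,
      x \in I <-> exists2 c : nat, a <= c <= b & nat_of_ord x = c %% l.

Definition is_elegant (G : graph) (l : nat) (f : G -> 'I_l) : Prop :=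
  exists I : G -> {set 'I_l},
    [/\ forall u, is_interval_mod (I u),
        forall u v, adj u v -> f v \in I u &
        forall u v, adj u v -> I u :&: I v = set0].

Definition sigma (h1 h2 h3 : nat) (G : graph) : option nat :=
  min_nat (fun l => 0 < l /\ exists f : G -> 'I_l, is_labelling h1 h2 h3 f).

Definition sigma_star (h1 h2 h3 : nat) (G : graph) : option nat :=
  min_nat (fun l => 0 < l /\
    exists f : G -> 'I_l, is_labelling h1 h2 h3 f /\ is_elegant f).

(* The infinite complete m-ary tree: vertices are the words over 'I_m, the root
   is the empty word, and the children of s are the words a :: s. *)
Section CompleteTree.
Variable m : nat.

Definition is_child (s t : seq 'I_m) : bool := (0 < size t) && (behead t == s).

Definition word_adj : rel (seq 'I_m) :=
  fun s t => is_child s t || is_child t s.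

Fact word_adj_sym : symmetric word_adj.
Proof. by move=> s t; rewrite /word_adj orbC. Qed.

Fact word_adj_irr : irreflexive word_adj.
Proof.
move=> [|a s] //; rewrite /word_adj orbb /is_child /=.
by apply/eqP => /(congr1 size) /= /eqP; rewrite ltn_eqF.
Qed.

Definition mary_tree_inf : graph := Graph word_adj_sym word_adj_irr.

(* The level of a vertex is its length as a word. *)
Definition mary_tree (k : nat) : graph :=
  induced (fun s : mary_tree_inf => size (s : seq 'I_m) <= k).
End CompleteTree.

(* The infinite (m+1)-regular tree: words over 'I_m.+1 without two equal
   consecutive letters.  The empty word has m+1 children; any other word b :: s
   has its parent s and the m children a :: b :: s with a != b. *)
Definition regular_tree_inf (m : nat) : graph :=
  induced (fun s : mary_tree_inf m.+1 =>
             sorted (fun a b => a != b) (s : seq 'I_m.+1)).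

Definition regular_tree (m k : nat) (c : regular_tree_inf m) : graph :=
  ball c k.

(* Main.v *)
Require Import Defs.
From HB Require Import structures.
From mathcomp Require Import all_boot all_order all_algebra.
From mathcomp Require Import boolp.
From mathcomp Require Import zify.

Set Implicit Arguments.
Unset Strict Implicit.
Unset Printing Implicit Defensive.

(** Write l for the span.

    Lower bound.  Every tree T of the four families contains a hub: a vertex w
    of degree m + 1 all of whose neighbours have degree m + 1.  The labels of
    the m + 1 neighbours of w are distinct and lie on an arc of l - 2h + 1
    labels around the circle, those at cyclic distance at least h from the label
    of w; hence l >= 2h + m ([span_ge_star]).  For l >= h + 2m + 1
    ([span_ge_hub]), turn the circle so that w gets label 0 and let v be the
    neighbour of w with the least label x.  Three sets of labels are pairwise
    disjoint: the m + 1 labels of N(w), the m + 1 labels of N(v), and the h - 1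
    integers strictly between x - h and x.  The first two are disjoint because a
    neighbour of w and one of v are distinct, there being no triangles, and are
    joined by a walk of length 3; the third
    meets neither N(w), by minimality of x, nor N(v), whose labels are at
    distance at least h from x.

    Upper bound.  Identify the regular tree with words having no two equal
    consecutive letters and colour the edge between s and c :: s by c; this is a
    proper edge colouring with m + 1 colours.  Give every vertex u an arc of
    m + 1 consecutive labels and let the colours index, through a cyclic shift,
    the labels on that arc: the neighbour of u along colour c receives the label
    in slot c.  An elegant labelling results as soon as the arc of u is at
    distance at least h from the label of u, arcs of adjacent vertices are
    disjoint, and the slot of u on the arc of a child v is the label of u.  When
    l is at least both h + 2m + 1 and 2h + m these constraints can be met for
    each child whatever the position of the parent, so the labelling is built by
    recursion on words ([step]); the other trees inherit it because they embed
    in the regular tree ([elegant_of_hom]).  Only adjacency has to be preserved: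
    the condition at distance 3 follows from disjointness of adjacent arcs
    ([elegant_of_local]). *)

(** * Minima and distances *)

Lemma min_nat_Some (P : nat -> Prop) (n : nat) :
  min_nat P = Some n <-> P n /\ forall i, P i -> n <= i.
Proof.
rewrite /min_nat; case: pselect => [exP | nexP]; last first.
  by split=> // -[Pn _]; case: nexP; exists n; apply/asboolP.
case: ex_minnP => i /asboolP Pi i_min; split=> [[<-] | [Pn n_min]].
  by split=> // j Pj; apply/i_min/asboolP.
congr Some; apply/eqP; rewrite eqn_leq n_min // andbT.
exact/i_min/asboolP.
Qed.

Section Distance.
Variable G : graph.
Implicit Types u v w : G.

Lemma walk1 u v : adj u v -> walk 1 u v.
Proof. by move=> uv; exists [:: v]; rewrite /= uv. Qed.

Lemma walk2 u v w : adj u v -> adj v w -> walk 2 u w.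
Proof. by move=> uv vw; exists [:: v; w]; rewrite /= uv vw. Qed.

Lemma walk3 u v w x : adj u v -> adj v w -> adj w x -> walk 3 u x.
Proof. by move=> uv vw wx; exists [:: v; w; x]; rewrite /= uv vw wx. Qed.

Lemma dist_le_walk n u v : walk n u v -> exists2 i, dist u v = Some i & i <= n.
Proof.
move=> uv_n; have exw : exists i, `[< walk i u v >] by exists n; apply/asboolP.
case: (ex_minnP exw) => i /asboolP uv_i i_min.
exists i; last exact/i_min/asboolP.
by apply/min_nat_Some; split=> // j uv_j; apply/i_min/asboolP.
Qed.

Lemma dist_gt0 i u v : u != v -> dist u v = Some i -> 0 < i.
Proof.
case: i => // uv /min_nat_Some[[[|a p] [_ /= uv0 _]] _] //.
by rewrite uv0 eqxx in uv.
Qed.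

Lemma adj_neq u v : adj u v -> u != v.
Proof. by apply: contraTneq => ->; rewrite adj_irr. Qed.

Lemma dist_adj u v : adj u v -> dist u v = Some 1.
Proof.
move=> uv; have [i dist_uv] := dist_le_walk (walk1 uv).
by have := dist_gt0 (adj_neq uv) dist_uv; case: i dist_uv => [|[]].
Qed.

Lemma dist_walk n u v : dist u v = Some n -> walk n u v.
Proof. by case/min_nat_Some. Qed.

Lemma dist1_adj u v : dist u v = Some 1 -> adj u v.
Proof.
by case/dist_walk=> [[|a [|b p]] [//= /andP[ua _] <- _]].
Qed.

Lemma dist2_common u v : dist u v = Some 2 ->
  u != v /\ exists2 w, adj w u & adj w v.
Proof.
move=> duv; split.
  apply/eqP=> uv; case/min_nat_Some: duv => _ duv.
  by suff /duv : walk 0 u v by []; exists [::].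
case/dist_walk: duv => [[|a [|b [|c p]]] [//= /and3P[ua ab _] <- _]].
by exists a; rewrite // adj_sym.
Qed.

Lemma dist3_path u v : dist u v = Some 3 ->
  exists a b, [/\ adj a u, adj a b & adj b v].
Proof.
case/dist_walk=> [[|a [|b [|c [|d p]]]] [//= /and4P[ua ab bc _] <- _]].
by exists a, b; rewrite adj_sym.
Qed.

End Distance.

(** * Cyclic gaps *)

Lemma cyc_absP l h (x y : 'I_l) :
  h <= cyc_abs l (x%:Z - y%:Z)%R <->
  [/\ x + h <= y \/ y + h <= x, x + h <= y + l & y + h <= x + l].
Proof.
have [xl yl] := (ltn_ord x, ltn_ord y).
by rewrite /cyc_abs; split=> [H | [H1 H2 H3]]; last lia; split; lia.
Qed.

(** Measuring labels from [c] onwards around the circle: a turn of the circle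
    that sends [c] to 0. *)
Definition rot l (c x : 'I_l) : nat := (x + (l - c)) %% l.

Lemma rotE l (c x : 'I_l) : rot c x = if c <= x then x - c else x + l - c.
Proof.
have [xl cl] := (ltn_ord x, ltn_ord c); rewrite /rot; case: leqP => cx.
  by rewrite (_ : x + (l - c) = x - c + l) ?modnDr ?modn_small; lia.
by rewrite modn_small; lia.
Qed.

Lemma rot_lt l (c x : 'I_l) : rot c x < l.
Proof. by have := ltn_ord c; rewrite ltn_mod; lia. Qed.

Lemma rot_inj l (c : 'I_l) : injective (rot c).
Proof.
move=> x y; have [[xl yl] cl] := (ltn_ord x, ltn_ord y, ltn_ord c).
rewrite !rotE => xy; apply: ord_inj; move: xy.
by case: (leqP c x); case: (leqP c y); lia.
Qed.

Lemma rot_gap l h (c x y : 'I_l) :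
  h <= cyc_abs l (x%:Z - y%:Z)%R ->
  rot c x + h <= rot c y \/ rot c y + h <= rot c x.
Proof.
case/cyc_absP; have [[xl yl] cl] := (ltn_ord x, ltn_ord y, ltn_ord c).
by rewrite !rotE; case: (leqP c x); case: (leqP c y); lia.
Qed.

Lemma rot_gap0 l h (c x : 'I_l) :
  h <= cyc_abs l (c%:Z - x%:Z)%R -> h <= rot c x /\ rot c x + h <= l.
Proof.
case/cyc_absP; have [xl cl] := (ltn_ord x, ltn_ord c).
by rewrite rotE; case: (leqP c x); lia.
Qed.

(** * Lower bound *)

Definition has_nbrs (G : graph) (n : nat) (v : G) : Prop :=
  exists nb : 'I_n -> G, injective nb /\ forall i, adj v (nb i).

(** Such a [w] with [n = m.+1] is the centre of a ball of radius 2 of the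
    (m+1)-regular tree, the only part of the tree that the lower bound sees. *)
Definition hub (G : graph) (n : nat) (w : G) : Prop :=
  has_nbrs n w /\ forall v, adj w v -> has_nbrs n v.

Definition triangle_free (G : graph) : Prop :=
  forall u v w : G, adj u v -> adj v w -> adj w u -> False.

Section LowerBound.
Variables (h m l : nat) (G : graph) (f : G -> 'I_l).
Implicit Types u v w : G.
Hypotheses (h_gt0 : 0 < h) (lab_f : is_labelling h 1 1 f).

Lemma label_gap u v : adj u v -> h <= cyc_abs l ((f u)%:Z - (f v)%:Z)%R.
Proof. by move=> uv; have [gap _ _] := lab_f u v; apply/gap/dist_adj. Qed.

(** A short walk between distinct vertices bounds their distance between 1 and 3,
    and each of these values forces a gap of at least 1 because [h > 0]. *)
Lemma label_neq n u v : walk n u v -> n <= 3 -> u != v -> f u != f v.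
Proof.
move=> uv_n n3 uv; have [i duv i_n] := dist_le_walk uv_n.
suff /cyc_absP[] : 1 <= cyc_abs l ((f u)%:Z - (f v)%:Z)%R.
  by move=> ne _ _; apply/eqP => fuv; move: ne; rewrite fuv; lia.
have [gap1 gap2 gap3] := lab_f u v; have := dist_gt0 uv duv.
case: i duv i_n => [|[|[|[|i]]]] // duv i_n _; last by lia.
- exact: leq_trans (gap1 duv).
- exact: gap2.
exact: gap3.
Qed.

Lemma nbrs_label_inj w u v : adj w u -> adj w v -> f u = f v -> u = v.
Proof.
move=> wu wv fuv; apply: contra_eq fuv.
by apply: (@label_neq 2) => //; apply: walk2 wv; rewrite adj_sym.
Qed.

Lemma nbr_labels_uniq n c v (nb : 'I_n -> G) :
  injective nb -> (forall i, adj v (nb i)) ->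
  uniq [seq rot c (f (nb i)) | i <- enum 'I_n].
Proof.
move=> nb_inj v_nb; rewrite map_inj_uniq ?enum_uniq // => i j /rot_inj.
by move=> fij; apply/nb_inj/(nbrs_label_inj (v_nb i) (v_nb j)).
Qed.

(** Seen from the label of [w], the neighbours have distinct labels in the
    interval from [h] to [l - h]. *)
Lemma span_ge_star w : has_nbrs m.+1 w -> 2 * h + m <= l.
Proof.
case=> nb [nb_inj w_nb]; pose c := f w.
have X_range i : h <= rot c (f (nb i)) /\ rot c (f (nb i)) + h <= l.
  exact/rot_gap0/label_gap.
have [X0 X0'] := X_range ord0.
have := @uniq_leq_size _ _ (iota h (l - 2 * h).+1)
          (nbr_labels_uniq c nb_inj w_nb).
rewrite size_map size_enum_ord size_iota => H.
suff : m.+1 <= (l - 2 * h).+1 by lia.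
apply: H => _ /mapP[i _ ->]; have [] := X_range i.
by rewrite mem_iota; lia.
Qed.

(** The [h - 1] labels just before the least neighbour label [g v0] are used
    neither around [w] nor around [v0]; the other [2m + 2] labels come from
    these two neighbourhoods, which are disjoint. *)
Lemma span_ge_hub w : triangle_free G -> hub m.+1 w -> h + 2 * m + 1 <= l.
Proof.
move=> noC3 [[nb [nb_inj w_nb]] nb_full].
pose c := f w; pose g v := rot c (f v).
pose i0 := [arg min_(i < ord0 : 'I_m.+1) g (nb i)]; pose v0 := nb i0.
have v0_min i : g v0 <= g (nb i).
  by rewrite /v0 /i0; case: arg_minnP => // j _ j_min; apply: j_min.
have w_v0 : adj w v0 := w_nb i0.
have [nb0 [nb0_inj v0_nb0]] := nb_full _ w_v0.
have [v0_h _] : h <= g v0 /\ g v0 + h <= l by apply/rot_gap0/label_gap.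
pose X := [seq g (nb i) | i <- enum 'I_m.+1].
pose Y := [seq g (nb0 i) | i <- enum 'I_m.+1].
pose Z := iota (g v0 - h).+1 h.-1.
have XZ : ~~ has [in X] Z.
  apply/hasPn => z; rewrite mem_iota => zZ; apply/mapP=> -[i _ zE].
  by have := v0_min i; lia.
have XY : ~~ has [in X] Y.
  apply/hasPn => _ /mapP[j _ ->]; apply/mapP => -[i _ /rot_inj fE].
  have jw : walk 3 (nb0 j) (nb i).
    by apply: (@walk3 _ _ v0 w); rewrite ?w_nb // adj_sym.
  have ij : nb0 j != nb i.
    by apply/eqP => ij; apply: (noC3 w v0 (nb0 j)); rewrite // ij adj_sym.
  by have := label_neq jw (leqnn 3) ij; rewrite fE eqxx.
have YZ : ~~ has [in Y] Z.
  apply/hasPn => z; rewrite mem_iota => zZ; apply/mapP=> -[j _ zE].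
  by have := rot_gap c (label_gap (v0_nb0 j)); rewrite -/(g _) -/(g _); lia.
have : uniq (X ++ Y ++ Z).
  rewrite cat_uniq (nbr_labels_uniq c nb_inj w_nb) has_cat negb_or XY XZ /=.
  by rewrite cat_uniq (nbr_labels_uniq c nb0_inj v0_nb0) YZ iota_uniq.
move/(@uniq_leq_size _ _ (iota 0 l)).
rewrite !size_cat ![size [seq _ | _ <- enum _]]size_map size_enum_ord.
rewrite !size_iota => H.
suff : m.+1 + (m.+1 + h.-1) <= l by lia.
apply: H => z; rewrite !mem_cat mem_iota /= add0n.
case/or3P=> [/mapP[i _ ->] | /mapP[i _ ->] |]; [exact: rot_lt..|].
by rewrite mem_iota; have := rot_lt c (f v0); rewrite -/(g _); lia.
Qed.

End LowerBound.

(** * Local conditions for an elegant labelling *)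

(** On a path u, a, b, v the labels of [u] and [v] lie in the disjoint sets
    [I a] and [I b], so that the condition at distance 3 comes for free and no
    distance in [G] has to be computed. *)
Lemma elegant_of_local (h l : nat) (G : graph) (f : G -> 'I_l)
    (I : G -> {set 'I_l}) :
  (forall u v, adj u v -> h <= cyc_abs l ((f u)%:Z - (f v)%:Z)%R) ->
  (forall w u v, adj w u -> adj w v -> f u = f v -> u = v) ->
  (forall u, is_interval_mod (I u)) ->
  (forall u v, adj u v -> f v \in I u) ->
  (forall u v, adj u v -> I u :&: I v = set0) ->
  is_labelling h 1 1 f /\ is_elegant f.
Proof.
move=> gap inj_nbr itvI fI disjI; split; last by exists I.
have gap1 u v : f u != f v -> 1 <= cyc_abs l ((f u)%:Z - (f v)%:Z)%R.
  move=> /eqP fuv; apply/cyc_absP.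
  have [ul vl] := (ltn_ord (f u), ltn_ord (f v)).
  suff : f u <> f v :> nat by split; lia.
  by move/val_inj.
move=> u v /=; split.
- by move/dist1_adj/gap.
- case/dist2_common=> uv [w wu wv]; apply: gap1.
  by apply: contra_neq uv; apply: inj_nbr wu wv.
case/dist3_path=> a [b [au ab bv]]; apply: gap1; apply/eqP => fuv.
have : f u \in I a :&: I b by rewrite inE fI // fuv fI.
by rewrite disjI // inE.
Qed.

(** * The four families of trees *)

Lemma is_childP m (u v : seq 'I_m) : is_child u v -> exists c, v = c :: u.
Proof. by case: v => // c v /= /eqP <-; exists c. Qed.

Lemma word_adjP m (u v : seq 'I_m) :
  word_adj u v -> (exists c, v = c :: u) \/ exists c, u = c :: v.
Proof. by case/orP=> /is_childP; [left | right]. Qed.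

(** Adjacent words have lengths of different parity. *)
Lemma word_triangle_free m (G : graph) (phi : G -> seq 'I_m) :
  (forall u v, adj u v -> word_adj (phi u) (phi v)) -> triangle_free G.
Proof.
move=> phi_adj u v w.
have parity x y : adj x y -> odd (size (phi y)) = ~~ odd (size (phi x)).
  by move/phi_adj/word_adjP=> -[] [c ->]; rewrite //= negbK.
by move=> /parity uv /parity vw /parity; rewrite vw uv; case: odd.
Qed.

Section InducedHub.
Variables (G : graph) (P : pred G) (n : nat).

Lemma has_nbrs_induced (v : induced P) :
  has_nbrs n (val v) -> (forall u, adj (val v) u -> P u) -> has_nbrs n v.
Proof.
case=> nb [nb_inj v_nb] nbP.
exists (fun i => exist _ (nb i) (nbP _ (v_nb i)) : induced P); split=> // i j.
by case/(congr1 val)/nb_inj.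
Qed.

Lemma hub_induced (w : G) :
  (forall i v, walk i w v -> i <= 2 -> P v) -> hub n w ->
  exists w' : induced P, hub n w'.
Proof.
move=> wP [w_nbrs nbr_nbrs].
have w0 : walk 0 w w by exists [::].
exists (exist _ w (wP _ _ w0 isT)); split=> [|v wv].
  by apply: has_nbrs_induced => // u /walk1 wu; exact: (wP 1).
apply: has_nbrs_induced => [|u vu]; first exact: nbr_nbrs.
by exact: (wP 2 _ (walk2 (wv : adj w (val v)) vu)).
Qed.

End InducedHub.

(** A non-root vertex has its parent besides its [m] children. *)
Lemma has_nbrs_mary m (v : mary_tree_inf m) : 0 < size (v : seq 'I_m) ->
  has_nbrs m.+1 v.
Proof.
case: v => // b s _.
exists (fun i => if unlift ord0 i is Some a then a :: b :: s else s).
split=> [i j|i]; last first.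
  by case: unliftP => [a|] _; rewrite /= /word_adj /is_child /= eqxx ?orbT.
case: unliftP => [a|] ->; case: unliftP => [a'|] -> //.
- by case=> ->.
- by move/(congr1 size) => /=; lia.
by move/(congr1 size) => /=; lia.
Qed.

Lemma size_walk_mary m i (u v : mary_tree_inf m) : walk i u v ->
  size (v : seq 'I_m) <= size (u : seq 'I_m) + i /\
  size (u : seq 'I_m) <= size (v : seq 'I_m) + i.
Proof.
case=> p [+ <- <-]; elim: p u => [|x p IHp] u /=; first by lia.
case/andP=> /word_adjP ux /IHp.
by case: ux => -[c ->] /=; lia.
Qed.

(** The root has only [m] neighbours, so a hub is neither the root nor next to
    it; hence level 2. *)
Lemma hub_mary m : 0 < m ->
  exists2 w : mary_tree_inf m, size (w : seq 'I_m) = 2 & hub m.+1 w.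
Proof.
case: m => // m _; exists [:: ord0; ord0] => //.
split=> [|v /walk1 /size_walk_mary /= sv]; first exact: has_nbrs_mary.
by apply: has_nbrs_mary; lia.
Qed.

(** There is one neighbour for each letter [c], the parent if the word starts
    with [c] and the child [c :: u] otherwise. *)
Lemma has_nbrs_regular m (v : regular_tree_inf m) : has_nbrs m.+1 v.
Proof.
pose nb (u : seq 'I_m.+1) (c : 'I_m.+1) :=
  if u is b :: s then if c == b then s else c :: u else [:: c].
have proper_nb c : sorted (fun a b => a != b) (nb (val v) c).
  case: v => -[|b s] //= bs.
  by case: eqP => [_ | /eqP cb]; [apply: path_sorted bs | rewrite /= cb].
exists (fun c => exist _ (nb (val v) c) (proper_nb c) : regular_tree_inf m).
split=> [c c' /(congr1 val) /=|c]; last first.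
  rewrite /= /induced_adj /= /word_adj /is_child; case: (val v) => [|b s] //=.
  by case: eqP => _ /=; rewrite eqxx ?orbT.
case: (sval v) => [|b s] /=; first by case.
case: eqP => [->|_]; case: eqP => [->|_] //.
- by move/(congr1 size) => /=; lia.
- by move/(congr1 size) => /=; lia.
by case.
Qed.

(** Embeds the m-ary tree in the (m+1)-regular one: the children of a word with
    first letter [b] are numbered by the [m] letters other than [b].  At the
    root, which has one child too few, [ord0] serves as [b]. *)
Fixpoint spread m (s : seq 'I_m) : seq 'I_m.+1 :=
  if s is a :: s' then lift (head ord0 (spread s')) a :: spread s' else [::].

Lemma spread_proper m (s : seq 'I_m) : sorted (fun a b => a != b) (spread s).
Proof.
elim: s => //= a s; case: (spread s) => //= b t ->.
by rewrite eq_sym neq_lift.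
Qed.

Lemma spread_inj m : injective (@spread m).
Proof.
elim=> [|a s IHs] [|b t] //= /eqP; rewrite eqseq_cons => /andP[/eqP ab /eqP st].
by move: ab; rewrite (IHs _ st) => /lift_inj->.
Qed.

Lemma spread_adj m (s t : seq 'I_m) :
  word_adj s t -> word_adj (spread s) (spread t).
Proof.
by case/word_adjP=> -[c ->]; rewrite /word_adj /is_child /= eqxx ?orbT.
Qed.

(** * An elegant labelling of the regular tree *)

Lemma modn_window l a x y :
  a <= x < a + l -> a <= y < a + l -> x = y %[mod l] -> x = y.
Proof.
wlog xy : x y / x <= y.
  by case: (leqP x y) => [xy H | /ltnW yx H] *; [|apply/esym]; apply: H.
move=> xa ya /esym /eqP; rewrite eqn_mod_dvd // => l_dvd.
by have := @dvdn_leq l (y - x); rewrite l_dvd; lia.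
Qed.

Lemma cyc_abs_modn l (l_gt0 : 0 < l) h (x y : nat) :
  x + h <= y -> y + h <= x + l ->
  h <= cyc_abs l ((x %% l)%N%:Z - (y %% l)%N%:Z)%R.
Proof.
move=> xy yx.
pose xo := Ordinal (ltn_pmod x l_gt0); pose yo := Ordinal (ltn_pmod y l_gt0).
apply/(@cyc_absP l h xo yo) => /=.
have := (divn_eq x l, divn_eq y l, ltn_pmod x l_gt0, ltn_pmod y l_gt0).
set qx := x %/ l; set qy := y %/ l; set rx := x %% l; set ry := y %% l.
case=> -[[xE yE] rx_l] ry_l.
have [q01 | q01] : qy = qx \/ qy = qx.+1 by nia.
  by rewrite q01 in yE; split; lia.
by rewrite q01 mulSn in yE; split; lia.
Qed.

Section Construction.
Variables (h m l : nat).
Hypotheses (h_gt0 : 0 < h).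
Hypotheses (l_ge1 : h + 2 * m + 1 <= l) (l_ge2 : 2 * h + m <= l).

(** A vertex with label [label mod l] whose neighbours get the labels of the arc
    [start, ..., start + m] mod l.  Keeping unreduced naturals avoids arithmetic
    mod l in the recursion: labels only grow with the depth. *)
Record place := Place { label : nat; start : nat; shift : nat }.

Implicit Types (s : place) (c : 'I_m.+1) (u v w : seq 'I_m.+1).

(** The label of the neighbour along the edge of colour [c]. *)
Definition slot s c : nat := start s + (c + shift s) %% m.+1.

(** The place of the child along colour [c].  Its arc must contain the label of
    the parent, which is [label s + l] one turn later, start after the arc of
    the parent, and keep distance [h] from [y]: [a] is the least start allowed
    by these three lower bounds.  The shift is chosen so that colour [c], seen from
    the child, leads back to the label of the parent. *)
Definition step s c : place :=
  let y := slot s c in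
  let a := maxn (label s + l - m) (maxn (start s + m).+1 (y + h)) in
  Place y a (label s + l - a + (m.+1 - c)).

(** The arc of a vertex is at cyclic distance at least [h] from its label. *)
Definition admissible s : Prop :=
  label s + h <= start s /\ start s + m + h <= label s + l.

Lemma slot_range s c : start s <= slot s c <= start s + m.
Proof.
by rewrite /slot; have := ltn_pmod (c + shift s) (ltn0Sn m); lia.
Qed.

Lemma slot_inj s c c' : slot s c = slot s c' %[mod l] -> c = c'.
Proof.
have [r r'] := (slot_range s c, slot_range s c').
move/(@modn_window l (start s)) => E.
apply: ord_inj; have /eqP : slot s c = slot s c' by apply: E; lia.
by rewrite eqn_add2l eqn_modDr !modn_small // => /eqP.
Qed.

(** The arc of the child still ends [h] before [y + l], for each of the three
    candidates for its start: [label s + l] is at most [y + l - h] as [s] is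
    admissible, [start s + 2m + 1 + h <= start s + l] by the first bound on [l],
    and [y + h + m + h <= y + l] by the second. *)
Lemma step_admissible s c : admissible s -> admissible (step s c).
Proof. by have := slot_range s c; rewrite /admissible /=; lia. Qed.

(** By admissibility of [s] and the bounds on [l], the start of the child's arc
    is at most [label s + l] and at least [label s + l - m], so that
    [label s + l] is on that arc; the shift of the child points [c] at it. *)
Lemma step_back s c : admissible s -> slot (step s c) c = label s + l.
Proof.
move=> adm; have r := slot_range s c; have cm := ltn_ord c.
rewrite {1}/slot /=; set a := maxn _ _.
have a_le : a <= label s + l by case: adm; rewrite /a; lia.
have a_ge : label s + l <= a + m by rewrite /a; lia.
have -> : c + (label s + l - a + (m.+1 - c)) = label s + l - a + m.+1 by lia.
by rewrite modnDr modn_small; lia.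
Qed.

(** Both arcs fit in one turn starting at [start s], so being disjoint as
    intervals of integers makes them disjoint mod [l]. *)
Lemma step_disjoint s c : admissible s ->
  start s + m < start (step s c) /\ start (step s c) + m < start s + l.
Proof. by have := slot_range s c; rewrite /admissible /=; lia. Qed.

Definition place_of u : place := foldr (fun c s => step s c) (Place 0 h 0) u.

Lemma place_admissible u : admissible (place_of u).
Proof.
elim: u => [|c u IHu] /=; last exact: step_admissible.
by rewrite /admissible /=; lia.
Qed.

(** The colour of the edge between adjacent words is the first letter of the
    longer one. *)
Definition color u v : 'I_m.+1 := head ord0 (if size u < size v then v else u).

Lemma color_child u c : color u (c :: u) = c.
Proof. by rewrite /color /= ltnS leqnn. Qed.

Lemma color_parent u c : color (c :: u) u = c.
Proof. by rewrite /color /= ltnNge leqnSn. Qed.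

(** Holds by definition towards a child, by [step_back] towards the parent. *)
Lemma label_slot u v : word_adj u v ->
  label (place_of v) = slot (place_of u) (color u v) %[mod l].
Proof.
case/word_adjP=> -[c ->]; first by rewrite color_child.
by rewrite color_parent /= step_back ?modnDr //; apply: place_admissible.
Qed.

Local Notation proper := (sorted (fun a b : 'I_m.+1 => a != b)).

(** The colouring of edges is proper: two children differ in their first letter,
    and the colour of the edge to the parent is the first letter of [w], which
    no child of [w] repeats. *)
Lemma color_inj w u v : proper u -> proper v ->
  word_adj w u -> word_adj w v -> color w u = color w v -> u = v.
Proof.
move=> + + /word_adjP[] [a ua] /word_adjP[] [b vb].
- by rewrite ua vb !color_child => _ _ ->.
- rewrite ua vb color_child color_parent => + _ ab.
  by rewrite ab /= eqxx.
- rewrite vb ua color_child color_parent => _ + ab.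
  by rewrite ab /= eqxx.
by move: vb; rewrite ua => -[].
Qed.

Lemma l_gt0 : 0 < l. Proof. by lia. Qed.

Definition word_label u : 'I_l :=
  Ordinal (ltn_pmod (label (place_of u)) l_gt0).

Definition word_arc u : {set 'I_l} :=
  [set x : 'I_l | val x \in [seq y %% l | y <- iota (start (place_of u)) m.+1]].

Lemma word_arcP u (x : 'I_l) : reflect
  (exists2 y, start (place_of u) <= y <= start (place_of u) + m &
              nat_of_ord x = y %% l)
  (x \in word_arc u).
Proof.
by rewrite inE; apply: (iffP mapP) => -[y]; rewrite ?mem_iota => y_range xE;
  exists y; rewrite ?mem_iota //; lia.
Qed.

Lemma word_label_gap u v : word_adj u v ->
  h <= cyc_abs l ((word_label u)%:Z - (word_label v)%:Z)%R.
Proof.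
move=> uv; rewrite /= (label_slot uv); apply: cyc_abs_modn l_gt0 _ _ _ _ _;
have := slot_range (place_of u) (color u v);
by case: (place_admissible u); lia.
Qed.

Lemma word_label_inj w u v : proper u -> proper v ->
  word_adj w u -> word_adj w v -> word_label u = word_label v -> u = v.
Proof.
move=> uu vv wu wv /(congr1 val) /=; rewrite (label_slot wu) (label_slot wv).
by move/slot_inj; apply: color_inj.
Qed.

Lemma word_arc_itv u : is_interval_mod (word_arc u).
Proof.
exists (start (place_of u)), (start (place_of u) + m).
split; first exact: leq_addr.
by move=> x; split=> /word_arcP.
Qed.

Lemma word_arc_label u v : word_adj u v -> word_label v \in word_arc u.
Proof.
move=> uv; apply/word_arcP; exists (slot (place_of u) (color u v)).
  exact: slot_range.
exact: label_slot.
Qed.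

Lemma word_arc_disjoint u v : word_adj u v -> word_arc u :&: word_arc v = set0.
Proof.
wlog [c ->] : u v / exists c, v = c :: u.
  move=> H uv; case/word_adjP: (uv) => [|uv']; first by move/H; apply.
  by rewrite setIC; apply: H; rewrite // word_adj_sym.
move=> _; apply/setP=> x; rewrite [RHS]inE.
apply/setIP => -[/word_arcP[y y_range xy] /word_arcP[z z_range xz]].
have [lt1 lt2] : start (place_of u) + m < start (place_of (c :: u)) /\
    start (place_of (c :: u)) + m < start (place_of u) + l.
  exact: step_disjoint (place_admissible u).
suff : y = z by lia.
by apply: (@modn_window l (start (place_of u))); [lia | lia | rewrite -xy].
Qed.

Lemma elegant_of_hom (G : graph) (phi : G -> regular_tree_inf m) :
  injective phi -> (forall u v : G, adj u v -> adj (phi u) (phi v)) ->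
  exists f : G -> 'I_l, is_labelling h 1 1 f /\ is_elegant f.
Proof.
move=> phi_inj phi_adj; exists (fun u : G => word_label (val (phi u))).
apply: (elegant_of_local (I := fun u : G => word_arc (val (phi u)))).
- by move=> u v /phi_adj; apply: word_label_gap.
- move=> w u v /phi_adj wu /phi_adj wv uv; apply/phi_inj/val_inj.
  exact: word_label_inj (valP (phi u)) (valP (phi v)) wu wv uv.
- by move=> u; apply: word_arc_itv.
- by move=> u v /phi_adj; apply: word_arc_label.
by move=> u v /phi_adj; apply: word_arc_disjoint.
Qed.

End Construction.

(** * The minimal span *)

Lemma sigma_of_hub h m (T : graph) (w : T) (phi : T -> regular_tree_inf m) :
  0 < h -> hub m.+1 w -> injective phi ->
  (forall u v, adj u v -> adj (phi u) (phi v)) ->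
  sigma h 1 1 T = sigma_star h 1 1 T /\
  sigma_star h 1 1 T = Some (maxn (h + 2 * m + 1) (2 * h + m)).
Proof.
move=> h_gt0 w_hub phi_inj phi_adj; set l := maxn _ _.
have noC3 : triangle_free T.
  by apply: (word_triangle_free (phi := fun u => val (phi u))) => u v /phi_adj.
have l_min i (f : T -> 'I_i) : is_labelling h 1 1 f -> l <= i.
  move=> lab_f; rewrite geq_max (span_ge_hub h_gt0 lab_f noC3 w_hub) /=.
  by case: w_hub => w_nbrs _; exact: (span_ge_star h_gt0 lab_f w_nbrs).
have [f [lab_f eleg_f]] :
    exists f : T -> 'I_l, is_labelling h 1 1 f /\ is_elegant f.
  by apply: elegant_of_hom phi_inj phi_adj; rewrite // /l ?leq_maxl ?leq_maxr.
have l_gt0 : 0 < l by rewrite /l; lia.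
have star : sigma_star h 1 1 T = Some l.
  apply/min_nat_Some; split; first by split=> //; exists f.
  by move=> i [_ [g [/l_min]]].
split=> //; rewrite star; apply/min_nat_Some; split.
  by split=> //; exists f.
by move=> i [_ [g /l_min]].
Qed.

Theorem theorem5p2 (h m k : nat) (T : graph)
  (hh : 1 <= h) (hm : 2 <= m) (hk : 2 <= k)
  (hT : [\/ 4 <= k /\ T = mary_tree m k,
            T = mary_tree_inf m,
            exists c : regular_tree_inf m, T = regular_tree k c |
            T = regular_tree_inf m]) :
  sigma h 1 1 T = sigma_star h 1 1 T /\
  sigma_star h 1 1 T = Some (maxn (h + 2 * m + 1) (2 * h + m)).
Proof.
pose spread_reg (s : mary_tree_inf m) : regular_tree_inf m :=
  exist _ (spread s) (spread_proper s).
have spread_reg_inj : injective spread_reg by move=> s t [/spread_inj].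
have spread_reg_adj s t : adj s t -> adj (spread_reg s) (spread_reg t).
  exact: spread_adj.
have [w w2 w_hub] := hub_mary (ltnW hm).
have reg_hub (c : regular_tree_inf m) : hub m.+1 c.
  by split=> [|v _]; apply: has_nbrs_regular.
case: hT => [[k4 ->] | -> | [c ->] | ->].
- have [|w' w'_hub] := @hub_induced (mary_tree_inf m)
      (fun s : seq 'I_m => size s <= k) _ w _ w_hub.
    by move=> i v /size_walk_mary [v_le _]; rewrite w2 in v_le; lia.
  pose phi (u : mary_tree m k) := spread_reg (val u).
  have phi_inj : injective phi by apply: inj_comp spread_reg_inj val_inj.
  by apply: (sigma_of_hub hh w'_hub phi_inj) => u v; apply: spread_reg_adj.
- exact: sigma_of_hub w_hub spread_reg_inj spread_reg_adj.
- have [|w' w'_hub] := @hub_induced (regular_tree_inf m)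
      (fun v => `[< exists2 i, dist c v = Some i & i <= k >]) _ c _ (reg_hub c).
    move=> i v /dist_le_walk[j cv_j j_i] i2; apply/asboolP; exists j => //.
    by apply: leq_trans hk; apply: leq_trans i2.
  exact: (sigma_of_hub hh w'_hub val_inj).
exact: (sigma_of_hub (phi := id) hh (reg_hub (exist _ [::] isT))).
Qed.
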